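(* Let $J\subseteq\mathbb{R}$ be an open interval, and let $\gamma\colon J\to\mathrm{AdS}$ be a null curve with bending $\kappa$. Consider two $\mathcal{T}$-transforms of $\gamma$, namely $\gamma_1=\mathcal{T}_{\xi_1,f_1}(\gamma)$ and $\gamma_2=\mathcal{T}_{\xi_2,f_2}(\gamma)$, with parameters $\xi_1\neq\xi_2$ (nonzero real constants) and transforming functions $f_1,f_2\colon J\to\mathbb{R}$ (so $f_i'+f_i^2=\kappa+\cosh(2\xi_i)$, $i=1,2$) with $f_1(s)\neq f_2(s)$ for all $s\in J$. Let $\kappa_1$ and $\kappa_2$ be the bendings of $\gamma_1$ and $\gamma_2$, respectively. Then the functions $$f_{2\to1}=-f_1+\frac{\cosh(2\xi_1)-\cosh(2\xi_2)}{f_1-f_2},\qquad f_{1\to2}=-f_2+\frac{\cosh(2\xi_1)-\cosh(2\xi_2)}{f_1-f_2}$$ satisfy, respectively, the Riccati equations $$f_{2\to1}'+f_{2\to1}^2=\kappa_1+\cosh(2\xi_2),\qquad f_{1\to2}'+f_{1\to2}^2=\kappa_2+\cosh(2\xi_1).$$ Moreover, $$\mathcal{T}_{\xi_2,f_{2\to1}}\bigl(\mathcal{T}_{\xi_1,f_1}(\gamma)\bigr)=\mathcal{T}_{\xi_1,f_{1\to2}}\bigl(\mathcal{T}_{\xi_2,f_2}(\gamma)\bigr),$$ and the bending of $\mathcal{T}_{\xi_2,f_{2\to1}}(\mathcal{T}_{\xi_1,f_1}(\gamma))$ is the function $$\kappa_{2\to1}=\kappa-2\bigl(\cosh(2\xi_1)-\cosh(2\xi_2)\bigr)\frac{f_1+f_2}{f_1-f_2}+2\left(\frac{\cosh(2\xi_1)-\cosh(2\xi_2)}{f_1-f_2}\right)^2.$$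 (The bending $\kappa_{1\to2}$ of $\mathcal{T}_{\xi_1,f_{1\to2}}(\mathcal{T}_{\xi_2,f_2}(\gamma))$ is $\kappa_{1\to2}=\kappa_{2\to1}$.)
   Context: Anti-de Sitter space. On the space $\mathbb{R}^{2,2}$ of real $2\times2$ matrices let $\langle\cdot,\cdot\rangle$ be the inner product of the quadratic form $X\mapsto-\det X$. $\mathrm{AdS}$ denotes $\mathrm{SL}(2,\mathbb{R})\subset\mathbb{R}^{2,2}$ with the induced Lorentzian metric. On $\Lambda^2(\mathbb{R}^{2,2})$ set $\langle\langle U\wedge V,W\wedge Z\rangle\rangle=\langle U,W\rangle\langle V,Z\rangle-\langle U,Z\rangle\langle V,W\rangle$. A null tangent vector $T\in T_X\mathrm{AdS}$ is future-directed if $\langle\langle I\wedge \mathsf{J},X\wedge T\rangle\rangle>0$, where $I$ is the identity matrix and $\mathsf{J}=\begin{pmatrix}0&1\\-1&0\end{pmatrix}$. Null curves. ''Null curve'' means a smooth immersed curve $\gamma\colon J\to\mathrm{AdS}$ ($J$ an open interval, prime $=d/ds$) with $\langle\gamma',\gamma'\rangle=0$, future-directed velocity, no inflection points ($\gamma'\wedge\gamma''\neq0$ everywhere), parameterized by proper time ($\langle\gamma'',\gamma''\rangle=4$). Its bending is $\kappa=-\frac1{16}\langle\gamma''',\gamma'''\rangle$. Spinor frame field. The spinor frame field along a null curve $\gamma$ with bending $\kappa$ is the smooth map $(F_+,F_-)\colon J\to\mathrm{SL}(2,\mathbb{R})\times\mathrm{SL}(2,\mathbb{R})$, defined up to a (common)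 sign, such that $\gamma=F_+F_-^{-1}$ and $$F_+'=F_+\begin{pmatrix}0&\kappa+1\\1&0\end{pmatrix},\qquad F_-'=F_-\begin{pmatrix}0&\kappa-1\\1&0\end{pmatrix}.$$ All null curves are understood to come with such a spinor frame field. $\mathcal{T}$-transform (for $\chi=0$) with parameter $\xi$ and transforming function $f$. Let $\gamma$ be a null curve with bending $\kappa$ and spinor frame field $(F_+,F_-)$, let $\xi\neq0$ be a real constant and let $f\colon J\to\mathbb{R}$ be a solution of the Riccati equation $f'+f^2=\kappa+\cosh(2\xi)$. Then $\mathcal{T}_{\xi,f}(\gamma)$ denotes the null curve $$\mathcal{T}_{\xi,f}(\gamma)=\pm F_+\begin{pmatrix}\tanh(\xi)&-\operatorname{csch}(\xi)\operatorname{sech}(\xi)\,f\\0&\coth(\xi)\end{pmatrix}F_-^{-1},$$ where the sign $\pm$ is fixed once and for all, the same in every transform. *)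

(* Defs.v *)
From HB Require Import structures.
From mathcomp Require Import all_boot all_order all_algebra.
From mathcomp Require Import all_classical all_reals all_analysis.

Set Implicit Arguments.
Unset Strict Implicit.
Unset Printing Implicit Defensive.

Import Order.TTheory GRing.Theory Num.Theory.
Import numFieldNormedType.Exports.

Local Open Scope ring_scope.
Local Open Scope classical_set_scope.

Section Hyperbolic.
Context {R : realType}.
Implicit Type x : R.

Definition cosh x : R := (expR x + expR (- x)) / 2.
Definition sinh x : R := (expR x - expR (- x)) / 2.
Definition tanh x : R := sinh x / cosh x.
Definition coth x : R := cosh x / sinh x.
Definition sech x : R := (cosh x)^-1.
Definition csch x : R := (sinh x)^-1.

End Hyperbolic.

Section AntiDeSitter.
Context {R : realType}.
Implicit Types U V W X Z T : 'M[R]_2.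

(* The matrix with rows (a, b) and (c, d). *)
Definition mx2 (a b c d : R) : 'M[R]_2 :=
  \matrix_(i, j)
    if i == 0 then (if j == 0 then a else b) else (if j == 0 then c else d).

(* Polarization of the quadratic form X |-> - \det X. *)
Definition ip U V : R := - (\det (U + V) - \det U - \det V) / 2.

(* U /\ V in Lambda^2 of the space of matrices, realized as the antisymmetric
   tensor u (x) v - v (x) u on the coordinate vectors u, v of U, V. *)
Definition wedge U V : 'M[R]_(2 * 2) :=
  (mxvec U)^T *m mxvec V - (mxvec V)^T *m mxvec U.

(* The inner product << U /\ V, W /\ Z >> of two decomposable bivectors. *)
Definition wedge_ip U V W Z : R := ip U W * ip V Z - ip U Z * ip V W.

(* AdS = SL(2, R) *)
Definition AdS : set 'M[R]_2 := [set X | \det X = 1].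

Definition Jmx : 'M[R]_2 := mx2 0 1 (-1) 0.

Definition future_directed X T : Prop := 0 < wedge_ip 1%:M Jmx X T.

End AntiDeSitter.

(* Maps on the interval J are represented by total functions on R of which only
   the values on J are constrained. J being open, the derivatives at the
   points of J depend only on the restriction to J. *)
Section NullCurves.
Context {R : realType}.
Implicit Types (J : set R) (g Fp Fm : R -> 'M[R]_2) (f k : R -> R).

Definition smooth_on J g : Prop :=
  forall (n : nat) (s : R), J s -> derivable (derive1n n g) s 1.

Record null_curve J g : Prop := NullCurve {
  null_curve_smooth : smooth_on J g;
  null_curve_AdS : forall s, J s -> AdS (g s);
  null_curve_immersed : forall s, J s -> derive1 g s != 0;
  null_curve_null : forall s, J s -> ip (derive1 g s) (derive1 g s) = 0;
  null_curve_future : forall s, J s -> future_directed (g s) (derive1 g s);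
  null_curve_no_inflection :
    forall s, J s -> wedge (derive1 g s) (derive1n 2 g s) != 0;
  null_curve_proper_time :
    forall s, J s -> ip (derive1n 2 g s) (derive1n 2 g s) = 4 }.

Definition bending g (s : R) : R :=
  - (16^-1) * ip (derive1n 3 g s) (derive1n 3 g s).

Record spinor_frame J g Fp Fm : Prop := SpinorFrame {
  spinor_frame_smoothp : smooth_on J Fp;
  spinor_frame_smoothm : smooth_on J Fm;
  spinor_frame_detp : forall s, J s -> \det (Fp s) = 1;
  spinor_frame_detm : forall s, J s -> \det (Fm s) = 1;
  spinor_frame_curve : forall s, J s -> g s = Fp s *m invmx (Fm s);
  spinor_frame_eqp : forall s, J s ->
    derive1 Fp s = Fp s *m mx2 0 (bending g s + 1) 1 0;
  spinor_frame_eqm : forall s, J s ->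
    derive1 Fm s = Fm s *m mx2 0 (bending g s - 1) 1 0 }.

(* Null curves are understood to come with a spinor frame field. *)
Definition framed_null_curve J g : Prop :=
  null_curve J g /\ exists Fp Fm, spinor_frame J g Fp Fm.

(* A spinor frame field along g (junk if there is none). It is unique up to a
   common sign, on which the transform below does not depend. *)
Definition frame_of J g : (R -> 'M[R]_2) * (R -> 'M[R]_2) :=
  xget (fun=> 1%:M, fun=> 1%:M) [set F | spinor_frame J g F.1 F.2].

Definition riccati J k (xi : R) f : Prop :=
  forall s, J s ->
    derivable f s 1 /\ derive1 f s + f s ^+ 2 = k s + cosh (2 * xi).

(* eps is the fixed overall sign, 1 or -1. *)
Definition Ttransform J (eps xi : R) f g (s : R) : 'M[R]_2 :=
  let F := frame_of J g in
  eps *: (F.1 s *m mx2 (tanh xi) (- (csch xi * sech xi * f s)) 0 (coth xi)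
            *m invmx (F.2 s)).

End NullCurves.

(* Main.v *)
Require Import Defs.
From HB Require Import structures.
From mathcomp Require Import all_boot all_order all_algebra.
From mathcomp Require Import all_classical all_reals all_analysis.
From mathcomp Require Import ring.

(** Along a null curve g = F_+ F_-^-1 with bending k, the first entry u of a row
(u, u') of F_+ (resp. F_-) solves the Schroedinger equation
u'' = (k + 1) u (resp. u'' = (k - 1) u). A solution f of the Riccati equation
f' + f^2 = k + cosh (2 xi) is the logarithmic derivative of a solution of the
same equation at energy cosh (2 xi), so it defines the Darboux transformation
u |-> u' - f u, which replaces k by k - 2 f'. On the frames it acts as right
multiplication by a matrix N_+ (resp. N_-) of determinant one; the normalizing
factors are sqrt 2 sinh xi and sqrt 2 cosh xi because cosh (2 xi) - 1 and
cosh (2 xi) + 1 are 2 sinh^2 xi and 2 cosh^2 xi. The matrix in the definition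
of the T-transform is exactly N_+ N_-^-1 ([darboux_quotient]), so the
T-transform of g has spinor frame (eps F_+ N_+, F_- N_-) and bending
k - 2 f' = 2 f^2 - k - 2 cosh (2 xi) ([spinor_system_Ttransform]).

That such a pair of solutions of the linear systems always comes from a null
curve with the prescribed bending is a computation with the derivatives
g^(i) = F_+ C_i F_-^-1, where C_1, C_2, C_3 are explicit matrices
([spinor_system_null_curve], [spinor_system_bending]). As 1, C_1 and C_2 span
the upper triangular matrices, F_+ M F_-^-1 with M upper triangular is a
combination of g, g', g''; so the T-transform does not depend on the chosen
frame ([TtransformE]), and the frame F_+ N_+, F_- N_- can be used to compute
the second transform.

The Riccati equation for f_{2->1} is then a substitution
([riccati_permuted]). The double transform in one order is
F_+ (N_+ M N_-^-1) F_-^-1 with N_+, N_- built from (xi1, f1) and M from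
(xi2, f_{2->1}); the inner product of matrices turns out to be symmetric under
the exchange of the indices ([darboux_permutability]), which is the
permutability statement. Both bending formulas follow from applying
k |-> 2 f^2 - k - 2 cosh (2 xi) twice. *)

Set Implicit Arguments.
Unset Strict Implicit.
Unset Printing Implicit Defensive.

Import Order.TTheory GRing.Theory Num.Theory.
Import numFieldNormedType.Exports.

Local Open Scope ring_scope.
Local Open Scope classical_set_scope.

(** * Two by two matrices *)

Section TwoByTwo.
Context {R : realType}.
Implicit Types (a b c d : R) (A B M N U V P Q : 'M[R]_2).

Lemma forall_ord2 (P : 'I_2 -> Prop) : P 0 -> P 1 -> forall i, P i.
Proof.
move=> P0 P1 [[|[|//]] lt2].
  by rewrite (_ : Ordinal _ = 0) //; exact: val_inj.
by rewrite (_ : Ordinal _ = 1) //; exact: val_inj.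
Qed.

Lemma mx2_eta M : M = mx2 (M 0 0) (M 0 1) (M 1 0) (M 1 1).
Proof. by apply/matrixP; do 2!elim/forall_ord2; rewrite !mxE. Qed.

Lemma mulmx2E A B i j : (A *m B) i j = A i 0 * B 0 j + A i 1 * B 1 j.
Proof.
rewrite mxE !big_ord_recl big_ord0 addr0.
by rewrite (_ : lift ord0 ord0 = 1 :> 'I_2) //; exact: val_inj.
Qed.

Lemma scalar_mx2 a : a%:M = mx2 a 0 0 a :> 'M[R]_2.
Proof. by rewrite [LHS]mx2_eta !mxE. Qed.

Lemma mul_mx2 a b c d a' b' c' d' :
  mx2 a b c d *m mx2 a' b' c' d' =
  mx2 (a * a' + b * c') (a * b' + b * d') (c * a' + d * c') (c * b' + d * d').
Proof. by rewrite [LHS]mx2_eta !mulmx2E !mxE. Qed.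

Lemma add_mx2 a b c d a' b' c' d' :
  mx2 a b c d + mx2 a' b' c' d' = mx2 (a + a') (b + b') (c + c') (d + d').
Proof. by rewrite [LHS]mx2_eta !mxE. Qed.

Lemma opp_mx2 a b c d : - mx2 a b c d = mx2 (- a) (- b) (- c) (- d).
Proof. by rewrite [LHS]mx2_eta !mxE. Qed.

Lemma scale_mx2 x a b c d :
  x *: mx2 a b c d = mx2 (x * a) (x * b) (x * c) (x * d).
Proof. by rewrite [LHS]mx2_eta !mxE. Qed.

Lemma det_mx2 a b c d : \det (mx2 a b c d) = a * d - b * c.
Proof.
rewrite (expand_det_row _ 0) !big_ord_recl big_ord0 /cofactor !det_mx11 !mxE /=.
ring.
Qed.

(** The adjugate, as a matrix whose entries are visibly linear in those of M:
for determinant one it is the inverse, so it turns the derivative of an inverse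
into that of a linear expression. *)
Definition adj2 M : 'M[R]_2 := mx2 (M 1 1) (- M 0 1) (- M 1 0) (M 0 0).

Lemma adj2_mx2 a b c d : adj2 (mx2 a b c d) = mx2 d (- b) (- c) a.
Proof. by rewrite /adj2 !mxE. Qed.

Lemma adj2Z x M : adj2 (x *: M) = x *: adj2 M.
Proof. by rewrite (mx2_eta M) scale_mx2 !adj2_mx2 scale_mx2 !mulrN. Qed.

Lemma adj2M M N : adj2 (M *m N) = adj2 N *m adj2 M.
Proof.
rewrite (mx2_eta M) (mx2_eta N) mul_mx2 !adj2_mx2 mul_mx2.
by congr mx2; ring.
Qed.

Lemma invmx_adj2 M : \det M = 1 -> invmx M = adj2 M.
Proof.
move=> dM; have Mu : M \in unitmx by rewrite unitmxE dM unitr1.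
suff MM : M *m adj2 M = 1%:M by rewrite -[RHS](mulKmx Mu) MM mulmx1.
move: dM; rewrite (mx2_eta M) det_mx2 adj2_mx2 mul_mx2 scalar_mx2 => <-.
by congr mx2; ring.
Qed.

Lemma det_invmx1 M : \det M = 1 -> \det (invmx M) = 1.
Proof. by move=> dM; rewrite det_inv dM invr1. Qed.

Lemma ip_mx2 a b c d a' b' c' d' :
  ip (mx2 a b c d) (mx2 a' b' c' d') =
  - (a * d' + a' * d - b * c' - b' * c) / 2.
Proof. by rewrite /ip add_mx2 !det_mx2; congr (- _ / _); ring. Qed.

(** \det is multiplicative, so SL(2) x SL(2) acts by isometries;
this reduces the inner products along a curve to those of constant matrices. *)
Lemma ip_sandwich P Q U V : \det P = 1 -> \det Q = 1 ->
  ip (P *m U *m Q) (P *m V *m Q) = ip U V.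
Proof.
move=> dP dQ.
by rewrite /ip -mulmxDl -mulmxDr !det_mulmx dP dQ !mul1r !mulr1.
Qed.

Lemma ipZr x U V : ip U (x *: V) = x * ip U V.
Proof.
by rewrite (mx2_eta U) (mx2_eta V) scale_mx2 !ip_mx2; field.
Qed.

Lemma ipC U V : ip U V = ip V U.
Proof. by rewrite (mx2_eta U) (mx2_eta V) !ip_mx2; congr (- _ / _); ring. Qed.

(** A null nonzero vector is not proportional to a non-null one. This derives
the absence of inflection points from the other conditions on a null curve. *)
Lemma wedge_neq0 U V : ip U U = 0 -> ip V V != 0 -> U != 0 -> wedge U V != 0.
Proof.
move=> iU iV; apply: contraNneq => W0.
(* the entries of the tensor are the 2 x 2 minors of U and V *)
have minor i j k l : U i j * V k l = V i j * U k l.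
  move/matrixP: W0 => /(_ (mxvec_index i j) (mxvec_index k l)) /eqP.
  rewrite !mxE !big_ord1 !mxE subr_eq0 => /eqP.
  by rewrite !mxvecE.
apply: contraTT (iV) => /eqP Un0; rewrite negbK.
have [[i j] Uij] : exists ij, U ij.1 ij.2 != 0.
  apply: contra_notP Un0 => /forallNP U0; apply/matrixP => i j.
  by rewrite mxE; apply/eqP/negP => /negP; exact: (U0 (i, j)).
have -> : V = (V i j / U i j) *: U.
  by apply/matrixP => k l; rewrite mxE mulrAC -minor mulrAC divff // mul1r.
by rewrite ipZr ipC ipZr iU !mulr0.
Qed.

End TwoByTwo.

(** * Derivatives and smoothness of matrix-valued functions *)

Section Calculus.
Context {R : realType}.
Implicit Types (J : set R) (F G : R -> 'M[R]_2) (s : R).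

Lemma is_derive_eq_on {V : normedModType R} J (f h : R -> V) s l :
  open J -> J s ->
  (forall t, J t -> f t = h t) -> is_derive s 1 h l -> is_derive s 1 f l.
Proof.
move=> Jo Js fh; apply: near_eq_is_derive.
near=> t; apply/esym/fh; near: t; exact: open_nbhs_nbhs.
Unshelve. all: by end_near. Qed.

Lemma is_derive_derive1 {V : normedModType R} (f : R -> V) s :
  derivable f s 1 -> is_derive s 1 f (derive1 f s).
Proof. by rewrite derive1E; exact: derivableP. Qed.

Lemma derive1_val {V : normedModType R} (f : R -> V) s (l : V) :
  is_derive s 1 f l -> derive1 f s = l.
Proof. by move=> fl; rewrite derive1E derive_val. Qed.

Lemma is_derive_mxP F s (L : 'M[R]_2) :
  is_derive s 1 F L <-> forall i j, is_derive s 1 (fun t => F t i j) (L i j).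
Proof.
split=> [FL i j|FL].
  have Fd : derivable F s 1 by [].
  apply: DeriveDef; first exact: (derivable_mxP F s 1).1.
  by case: FL => _ <-; rewrite derive_mx // mxE.
have Fd : derivable F s 1 by apply/derivable_mxP => i j; case: (FL i j).
apply: DeriveDef => //; rewrite derive_mx //; apply/matrixP => i j.
by rewrite mxE; case: (FL i j).
Qed.

Lemma is_derive_mulmx F G s (L M : 'M[R]_2) :
  is_derive s 1 F L -> is_derive s 1 G M ->
  is_derive s 1 (fun t => F t *m G t) (L *m G s + F s *m M).
Proof.
move=> /is_derive_mxP FL /is_derive_mxP GM; apply/is_derive_mxP => i j.
under eq_fun do rewrite mulmx2E.
have FG := is_deriveD (is_deriveM (FL i 0) (GM 0 j))
                      (is_deriveM (FL i 1) (GM 1 j)).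
apply: is_derive_eq FG _.
rewrite mxE !mulmx2E /GRing.scale /= addrACA addrC.
by rewrite [G s 0 j * _]mulrC [G s 1 j * _]mulrC.
Qed.

Lemma is_derive_adj2 F s (L : 'M[R]_2) :
  is_derive s 1 F L -> is_derive s 1 (fun t => adj2 (F t)) (adj2 L).
Proof.
move=> /is_derive_mxP FL; apply/is_derive_mxP.
have FN i j : is_derive s 1 (fun t => - F t i j) (- L i j).
  exact: (is_deriveN (FL i j)).
do 2!elim/forall_ord2; rewrite mxE /=; under eq_fun do rewrite mxE /=; exact.
Qed.

(** Differentiability n times on J, in a recursive form: closure under sums and
products is then an induction on n applied to the derivatives. *)
Fixpoint Cn {V : normedModType R} n J (f : R -> V) : Prop :=
  if n is m.+1 then (forall s, J s -> derivable f s 1) /\ Cn m J (derive1 f)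
  else True.

Lemma Cn_eq {V : normedModType R} n J (f h : R -> V) : open J ->
  (forall s, J s -> f s = h s) -> Cn n J h -> Cn n J f.
Proof.
move=> Jo; elim: n f h => //= n IHn f h fh [hd hn].
have fd s (Js : J s) : is_derive s 1 f (derive1 h s).
  by apply: (@is_derive_eq_on _ J _ h) => //; exact/is_derive_derive1/hd.
split=> [s /fd []//|]; apply: (IHn _ (derive1 h)) => // s Js.
exact/derive1_val/fd.
Qed.

(** It is enough to know a derivative on J, which need not be that of f
elsewhere. *)
Lemma CnS {V : normedModType R} n J (f h : R -> V) : open J ->
  (forall s, J s -> is_derive s 1 f (h s)) -> Cn n J h -> Cn n.+1 J f.
Proof.
move=> Jo fh hn; split=> [s /fh []//|].
by apply: (@Cn_eq _ _ _ _ h) => // s Js; exact/derive1_val/fh.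
Qed.

Lemma CnW {V : normedModType R} n J (f : R -> V) : Cn n.+1 J f -> Cn n J f.
Proof. by elim: n f => //= n IHn f [fd /IHn fn]. Qed.

Lemma Cn_is_derive {V : normedModType R} n J (f : R -> V) s :
  Cn n.+1 J f -> J s ->
  is_derive s 1 f (derive1 f s).
Proof. by move=> [fd _] Js; exact/is_derive_derive1/fd. Qed.

Lemma smooth_onP J F : smooth_on J F <-> forall n, Cn n J F.
Proof.
split=> [Fs n|Fs n s Js].
  elim: n F Fs => //= n IHn F Fs; split; first exact: (Fs 0).
  by apply: IHn => m s Js; rewrite -derive1Sn; exact: (Fs m.+1).
elim: n F Fs => [|n IHn] F Fs; first exact: (Fs 1).1.
by rewrite derive1Sn; apply: IHn => m; case: (Fs m.+1).
Qed.

Lemma Cn_cst {V : normedModType R} n J (c : V) : open J -> Cn n J (fun=> c).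
Proof.
move=> Jo; elim: n c => // n IHn c; apply: (@CnS _ _ _ _ (fun=> 0)) => //.
Qed.

Lemma CnD n J (f h : R -> R) : open J -> Cn n J f -> Cn n J h ->
  Cn n J (fun s => f s + h s).
Proof.
move=> Jo; elim: n f h => // n IHn f h fn hn.
apply: (@CnS _ _ _ _ (fun s => derive1 f s + derive1 h s)) => //.
  move=> s Js; have := Cn_is_derive fn Js; have := Cn_is_derive hn Js => ? ?.
  exact: (@is_deriveD _ _ _ f h).
by apply: IHn; [case: fn|case: hn].
Qed.

Lemma CnM n J (f h : R -> R) : open J -> Cn n J f -> Cn n J h ->
  Cn n J (fun s => f s * h s).
Proof.
move=> Jo; elim: n f h => // n IHn f h fn hn.
apply: (@CnS _ _ _ _ (fun s => f s * derive1 h s + h s * derive1 f s)) => //.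
  move=> s Js; have := Cn_is_derive fn Js; have := Cn_is_derive hn Js => ? ?.
  exact: (@is_deriveM _ _ f h).
by apply: CnD => //; apply: IHn => //;
  [exact: CnW fn|case: hn|exact: CnW hn|case: fn].
Qed.

Lemma Cn_mxP n J F :
  open J -> Cn n J F <-> forall i j, Cn n J (fun t => F t i j).
Proof.
move=> Jo; elim: n F => //= n IHn F.
have eq1 i j s : derivable F s 1 ->
    derive1 F s i j = derive1 (fun t => F t i j) s.
  move=> /is_derive_derive1 /is_derive_mxP /(_ i j) Fd.
  by rewrite (derive1_val Fd).
split=> [[Fd /IHn Fn] i j|Fn].
  split=> [s Js|]; first exact: (derivable_mxP F s 1).1 (Fd s Js) i j.
  by apply: Cn_eq (Fn i j) => // s Js; rewrite eq1 //; exact: Fd.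
have Fd s : J s -> derivable F s 1.
  by move=> Js; apply/derivable_mxP => i j; exact: (Fn i j).1.
split=> //; apply/IHn => i j; apply: Cn_eq (Fn i j).2 => // s Js.
by rewrite eq1 //; exact: Fd.
Qed.

Lemma Cn_mulmx n J F G : open J -> Cn n J F -> Cn n J G ->
  Cn n J (fun t => F t *m G t).
Proof.
move=> Jo /(Cn_mxP _ _ Jo) Fn /(Cn_mxP _ _ Jo) Gn; apply/(Cn_mxP _ _ Jo) => i j.
under eq_fun do rewrite mulmx2E.
by apply: CnD => //; apply: CnM.
Qed.

Lemma Cn_mx2 n J (a b c d : R -> R) : open J ->
  Cn n J a -> Cn n J b -> Cn n J c -> Cn n J d ->
  Cn n J (fun t => mx2 (a t) (b t) (c t) (d t)).
Proof.
move=> Jo an bn cn dn; apply/(Cn_mxP _ _ Jo).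
by do 2!elim/forall_ord2; (under eq_fun do rewrite mxE /=).
Qed.

Lemma CnN n J (f : R -> R) : open J -> Cn n J f -> Cn n J (fun s => - f s).
Proof.
move=> Jo fn; under eq_fun do rewrite -mulN1r.
by apply: CnM => //; exact: Cn_cst.
Qed.

Lemma Cn_adj2 n J F : open J -> Cn n J F -> Cn n J (fun t => adj2 (F t)).
Proof.
by move=> Jo /(Cn_mxP _ _ Jo) Fn; apply: Cn_mx2 => //; apply: CnN.
Qed.

End Calculus.

(** * Spinor frames, null curves and Darboux transformations *)

Section Frames.
Context {R : realType}.
Implicit Types (J : set R) (k f : R -> R) (g Fp Fm F : R -> 'M[R]_2) (s : R).

Definition frame_mx (a : R) : 'M[R]_2 := mx2 0 a 1 0.

(** A spinor frame in which the function k in the linear systems is arbitrary.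
It turns out to be the bending of g, but a frame built by a transformation is
first known only in this form. *)
Record spinor_system J k g Fp Fm : Prop := SpinorSystem {
  spinor_system_smoothp : smooth_on J Fp;
  spinor_system_smoothm : smooth_on J Fm;
  spinor_system_detp : forall s, J s -> \det (Fp s) = 1;
  spinor_system_detm : forall s, J s -> \det (Fm s) = 1;
  spinor_system_curve : forall s, J s -> g s = Fp s *m invmx (Fm s);
  spinor_system_eqp : forall s, J s ->
    is_derive s 1 Fp (Fp s *m frame_mx (k s + 1));
  spinor_system_eqm : forall s, J s ->
    is_derive s 1 Fm (Fm s *m frame_mx (k s - 1)) }.

Lemma spinor_frame_system J g Fp Fm :
  spinor_frame J g Fp Fm -> spinor_system J (bending g) g Fp Fm.
Proof.
case=> sp sm dp dm gE ep em; split=> // s Js.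
  have Fd : derivable Fp s 1 := sp 0 s Js.
  by have := is_derive_derive1 Fd; rewrite ep.
have Fd : derivable Fm s 1 := sm 0 s Js.
by have := is_derive_derive1 Fd; rewrite em.
Qed.

(** The frame matrices are traceless, so their adjugate is their opposite and
F_-' = F_- B gives (F_-^-1)' = - B F_-^-1. *)
Lemma is_derive_sandwich J Fp Fm (C : 'M[R]_2) a b s : open J -> J s ->
  (forall t, J t -> \det (Fm t) = 1) ->
  is_derive s 1 Fp (Fp s *m frame_mx a) ->
  is_derive s 1 Fm (Fm s *m frame_mx b) ->
  is_derive s 1 (fun t => Fp t *m C *m invmx (Fm t))
    (Fp s *m (frame_mx a *m C - C *m frame_mx b) *m invmx (Fm s)).
Proof.
move=> Jo Js dm dFp dFm.
apply: (@is_derive_eq_on _ _ J _ (fun t => (Fp t *m C) *m adj2 (Fm t))) => //.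
  by move=> t Jt; rewrite invmx_adj2 ?dm.
apply: is_derive_eq.
  apply: is_derive_mulmx (is_derive_adj2 dFm).
  exact: is_derive_mulmx dFp (is_derive_cst C s 1).
rewrite mulmx0 addr0 adj2M -invmx_adj2 ?dm //.
rewrite (_ : adj2 (frame_mx b) = - frame_mx b); last first.
  by rewrite adj2_mx2 opp_mx2 oppr0.
by rewrite mulmxBr mulmxBl !mulmxA mulmxN mulNmx.
Qed.

Section Curve.
Context (J : set R) (k : R -> R) (g Fp Fm : R -> 'M[R]_2).
Context (Jo : open J) (sys : spinor_system J k g Fp Fm).

Let sw C s := Fp s *m C *m invmx (Fm s).

Let is_derive_sw h C D s : J s -> (forall t, J t -> h t = sw C t) ->
  frame_mx (k s + 1) *m C - C *m frame_mx (k s - 1) = D ->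
  is_derive s 1 h (sw D s).
Proof.
move=> Js hC <-; apply: (is_derive_eq_on Jo Js hC).
apply: (is_derive_sandwich C Jo Js (spinor_system_detm sys)).
  exact: (spinor_system_eqp sys).
exact: (spinor_system_eqm sys).
Qed.

Lemma spinor_system_curve_sw s : J s -> g s = sw 1%:M s.
Proof. by move=> Js; rewrite /sw mulmx1 (spinor_system_curve sys). Qed.

Lemma spinor_system_derive1 s : J s -> derive1 g s = sw (mx2 0 2 0 0) s.
Proof.
move=> Js; apply/derive1_val/(is_derive_sw Js spinor_system_curve_sw).
by rewrite mulmx1 mul1mx /frame_mx opp_mx2 add_mx2; congr mx2; ring.
Qed.

Lemma spinor_system_derive2 s : J s -> derive1n 2 g s = sw (mx2 (-2) 0 0 2) s.
Proof.
move=> Js; apply/derive1_val/(is_derive_sw Js spinor_system_derive1).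
by rewrite /frame_mx !mul_mx2 opp_mx2 add_mx2; congr mx2; ring.
Qed.

Lemma spinor_system_derive3 s : J s ->
  derive1n 3 g s = sw (mx2 0 (4 * k s) (-4) 0) s.
Proof.
move=> Js; apply/derive1_val/(is_derive_sw Js spinor_system_derive2).
by rewrite /frame_mx !mul_mx2 opp_mx2 add_mx2; congr mx2; ring.
Qed.

Let ip_sw C D s : J s -> ip (sw C s) (sw D s) = ip C D.
Proof.
case: sys => _ _ dp dm _ _ _ Js; apply: ip_sandwich; first exact: dp.
exact/det_invmx1/dm.
Qed.

Lemma spinor_system_bending s : J s -> bending g s = k s.
Proof.
by move=> Js; rewrite /bending spinor_system_derive3 // ip_sw // ip_mx2; field.
Qed.

Lemma spinor_system_smooth : smooth_on J g.
Proof.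
apply/smooth_onP => n.
apply: (@Cn_eq _ _ _ _ _ (fun t => Fp t *m adj2 (Fm t))) => // [s Js|].
  by case: sys => _ _ _ dm -> // _ _; rewrite invmx_adj2 ?dm.
case: sys => /smooth_onP sp /smooth_onP sm _ _ _ _ _.
by apply: Cn_mulmx => //; exact: Cn_adj2.
Qed.

(** Up to a factor 1/2, the product that decides the time orientation is the sum
of the squares of the entries in the first columns of F_+ and F_-. *)
Lemma spinor_system_future s : J s -> future_directed (g s) (derive1 g s).
Proof.
move=> Js; rewrite /future_directed /wedge_ip spinor_system_derive1 //.
have := sys => -[_ _ dp dm -> // _ _].
move: (dp _ Js) (dm _ Js) => {}dp {}dm; rewrite /sw invmx_adj2 //.
move: (Fp s) (Fm s) dp dm => M N.
rewrite (mx2_eta M) (mx2_eta N) adj2_mx2 !det_mx2 scalar_mx2 /Jmx.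
rewrite !mul_mx2 !ip_mx2.
move: (M 0 0) (M 0 1) (M 1 0) (M 1 1) => a b c d.
move: (N 0 0) (N 0 1) (N 1 0) (N 1 1) => p q r t dM dN.
(* the weights of the two sums of squares are the determinants of N and M *)
rewrite [X in 0 < X](_ : _ = ((a ^+ 2 + c ^+ 2) * (p * t - q * r) +
  (p ^+ 2 + r ^+ 2) * (a * d - b * c)) / 2); last by field.
rewrite dM dN !mulr1.
have ac0 : 0 < a ^+ 2 + c ^+ 2.
  rewrite lt_def addr_ge0 ?sqr_ge0 // andbT paddr_eq0 ?sqr_ge0 // !sqrf_eq0.
  apply: contra_eqN dM => /andP[/eqP -> /eqP ->].
  by rewrite mul0r mulr0 subrr eq_sym oner_eq0.
by rewrite divr_gt0 // ltr_wpDr // addr_ge0 ?sqr_ge0.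
Qed.

Lemma spinor_system_null_curve : null_curve J g.
Proof.
have T0 s (Js : J s) : ip (derive1 g s) (derive1 g s) = 0.
  by rewrite spinor_system_derive1 // ip_sw // ip_mx2; field.
have A4 s (Js : J s) : ip (derive1n 2 g s) (derive1n 2 g s) = 4.
  by rewrite spinor_system_derive2 // ip_sw // ip_mx2; field.
have Tn0 s (Js : J s) : derive1 g s != 0.
  apply: contraTneq (spinor_system_future Js) => T_eq0.
  have ip0 U : ip U 0 = 0 :> R by rewrite -[X in ip U X](scale0r U) ipZr mul0r.
  by rewrite /future_directed /wedge_ip T_eq0 !ip0 mulr0 mul0r subrr ltxx.
split=> //; first exact: spinor_system_smooth.
- move=> s Js; rewrite /AdS /= (spinor_system_curve sys) // det_mulmx.
  rewrite (spinor_system_detp sys) // mul1r det_invmx1 //.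
  exact: (spinor_system_detm sys).
- exact: spinor_system_future.
- move=> s Js; have A0 : ip (derive1n 2 g s) (derive1n 2 g s) != 0.
    by rewrite (A4 s Js) pnatr_eq0.
  exact: (wedge_neq0 (T0 s Js) A0 (Tn0 s Js)).
Qed.

Lemma spinor_system_frame : spinor_frame J g Fp Fm.
Proof.
case: (sys) => sp sm dp dm gE ep em; split=> // s Js.
  by rewrite spinor_system_bending // -/(frame_mx _); exact/derive1_val/ep.
by rewrite spinor_system_bending // -/(frame_mx _); exact/derive1_val/em.
Qed.

(** The matrices of g, g' and g'' span the upper triangular matrices, so this
sandwich is an expression in g alone. *)
Lemma spinor_system_upper a b d s : J s ->
  sw (mx2 a b 0 d) s = ((a + d) / 2) *: g s + (b / 2) *: derive1 g s
                       + ((d - a) / 4) *: derive1n 2 g s.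
Proof.
move=> Js; rewrite spinor_system_curve_sw // spinor_system_derive1 //.
rewrite spinor_system_derive2 // /sw ![_ *: (_ *m invmx _)]scalemxAl !scalemxAr.
rewrite -!mulmxDl -!mulmxDr.
rewrite scalar_mx2 !scale_mx2 !add_mx2; congr (_ *m mx2 _ _ _ _ *m _); by field.
Qed.

End Curve.

(** The transform can be computed in any frame, since its matrix is upper
triangular. *)
Lemma TtransformE J eps xi f g Fp Fm s :
  open J -> spinor_frame J g Fp Fm -> J s ->
  Ttransform J eps xi f g s =
  eps *: (Fp s *m mx2 (tanh xi) (- (csch xi * sech xi * f s)) 0 (coth xi)
            *m invmx (Fm s)).
Proof.
move=> Jo frF Js; rewrite /Ttransform; congr (_ *: _).
have : spinor_frame J g (frame_of J g).1 (frame_of J g).2.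
  by apply: (@xgetPex _ _ [set F | spinor_frame J g F.1 F.2]); exists (Fp, Fm).
move=> /spinor_frame_system /spinor_system_upper -> //.
by move: frF => /spinor_frame_system /spinor_system_upper ->.
Qed.

(** The action on a row (u, u') of the transformation
u |-> (u' - x u) / (sqrt 2 c) for u'' = a u, where x satisfies the Riccati
equation x' + x^2 = a + 2 c^2. *)
Definition darboux_mx (c x : R) : 'M[R]_2 :=
  (Num.sqrt 2 * c)^-1 *: mx2 (- x) (x ^+ 2 - 2 * c ^+ 2) 1 (- x).

Lemma sqr_sqrt2 : Num.sqrt 2 ^+ 2 = 2 :> R.
Proof. by rewrite sqr_sqrtr ?ler0n. Qed.

Lemma det_darboux_mx (c x : R) : c != 0 -> \det (darboux_mx c x) = 1.
Proof.
by move=> c0; rewrite detZ det_mx2 exprVn exprMn sqr_sqrt2; field.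
Qed.

Lemma is_derive_darboux_mx c f df s : is_derive s 1 f df ->
  is_derive s 1 (fun t => darboux_mx c (f t))
    ((Num.sqrt 2 * c)^-1 *: mx2 (- df) (2 * f s * df) 0 (- df)).
Proof.
move=> fd.
apply: (@is_deriveZ _ _ _
  (fun t => mx2 (- f t) (f t ^+ 2 - 2 * c ^+ 2) 1 (- f t))).
apply/is_derive_mxP.
have fN := is_deriveN fd.
have fq : is_derive s 1 (f ^+ 2 - cst (2 * c ^+ 2)) (2 * f s * df).
  by apply: is_derive_eq; rewrite subr0 expr1.
do 2!elim/forall_ord2; rewrite mxE /=; (under eq_fun do rewrite mxE /=).
- exact: fN.
- exact: fq.
- exact: is_derive_cst.
- exact: fN.
Qed.

(** The Darboux transformation: it maps solutions of u'' = a u to solutions of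
the equation with potential a - 2 f'. *)
Lemma is_derive_darboux F f a df c s :
  is_derive s 1 F (F s *m frame_mx a) -> is_derive s 1 f df ->
  df + f s ^+ 2 = a + 2 * c ^+ 2 ->
  is_derive s 1 (fun t => F t *m darboux_mx c (f t))
    (F s *m darboux_mx c (f s) *m frame_mx (a - 2 * df)).
Proof.
move=> dF fd ric; apply: is_derive_eq.
  exact: is_derive_mulmx dF (is_derive_darboux_mx c fd).
rewrite -!mulmxA -mulmxDr; congr (_ *m _).
have -> : a = df + f s ^+ 2 - 2 * c ^+ 2 by rewrite ric addrK.
rewrite /frame_mx -scalemxAr -scalemxAl -scalerDr; congr (_ *: _).
by rewrite !mul_mx2 add_mx2; congr mx2; ring.
Qed.

Lemma Cn_darboux n J c f :
  open J -> Cn n J f -> Cn n J (fun t => darboux_mx c (f t)).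
Proof.
move=> Jo fn; have cn x : Cn n J (fun=> x : R) by exact: Cn_cst.
rewrite /darboux_mx; under eq_fun do rewrite scale_mx2 expr2.
have Nn := CnN Jo fn; have ffn := CnM Jo fn fn.
by apply: Cn_mx2 => //; do ?apply: CnM; do ?apply: CnD.
Qed.

End Frames.

(** * The T-transform and its permutability *)

Section Transform.
Context {R : realType}.
Implicit Types (J : set R) (k f : R -> R) (g Fp Fm : R -> 'M[R]_2).
Implicit Types s xi eps : R.

Lemma cosh_gt0 xi : 0 < cosh xi.
Proof. by rewrite divr_gt0 // addr_gt0 ?expR_gt0. Qed.

Lemma cosh_neq0 xi : cosh xi != 0.
Proof. by rewrite gt_eqF // cosh_gt0. Qed.

Lemma sinh_neq0 xi : xi != 0 -> sinh xi != 0.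
Proof.
move=> xi0; rewrite mulf_neq0 ?invr_eq0 ?pnatr_eq0 // subr_eq0.
apply: contra_neq xi0 => /expR_inj /eqP.
by rewrite -addr_eq0 -mulr2n mulrn_eq0 => /eqP.
Qed.

Lemma cosh_sqr xi : cosh xi ^+ 2 = 1 + sinh xi ^+ 2.
Proof.
rewrite /cosh /sinh expRN; have := gt_eqF (expR_gt0 xi) => /negbT e0.
by field.
Qed.

Lemma cosh_double xi : cosh (2 * xi) = cosh xi ^+ 2 + sinh xi ^+ 2.
Proof.
rewrite /cosh /sinh -mulrN !mulr_natl !mulr2n !expRD !expRN.
by have := gt_eqF (expR_gt0 xi) => /negbT e0; field.
Qed.

Lemma cosh_double_sinh xi : cosh (2 * xi) = 1 + 2 * sinh xi ^+ 2.
Proof. by rewrite cosh_double cosh_sqr; ring. Qed.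

Lemma cosh_double_cosh xi : cosh (2 * xi) = 2 * cosh xi ^+ 2 - 1.
Proof. by rewrite cosh_double_sinh cosh_sqr; ring. Qed.

Lemma Cn_bending J g n : open J -> smooth_on J g -> Cn n J (bending g).
Proof.
move=> Jo /smooth_onP gs; have [_ [_ [_ g3]]] := gs n.+3.
have {g3} U i j : Cn n J (fun s => derive1n 3 g s i j).
  exact: (Cn_mxP _ _ Jo).1.
pose h s := 16^-1 * (derive1n 3 g s 0 0 * derive1n 3 g s 1 1
                     + - (derive1n 3 g s 0 1 * derive1n 3 g s 1 0)).
apply: (@Cn_eq _ _ _ _ _ h) => // [s _|].
  by rewrite /bending [derive1n 3 g s]mx2_eta ip_mx2 /h; field.
apply: CnM => //; first exact: Cn_cst.
by apply: CnD => //; first exact: CnM; apply: CnN => //; exact: CnM.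
Qed.

(** The Riccati equation expresses f' through f and k, so f inherits the
smoothness of k one derivative at a time. *)
Lemma riccati_Cn J k xi f n : open J -> (forall m, Cn m J k) ->
  riccati J k xi f -> Cn n J f.
Proof.
move=> Jo ks ric; elim: n => // n fn.
apply: (@CnS _ _ _ _ _ (fun s => (k s + cosh (2 * xi)) + - (f s * f s))) => //.
  move=> s Js; have [fd <-] := ric s Js.
  by rewrite expr2 addrK; exact: is_derive_derive1.
apply: CnD => //; first by apply: CnD => //; exact: Cn_cst.
by apply: CnN => //; exact: CnM.
Qed.

(** The matrix of the T-transform is the quotient of the Darboux matrices of the
two frame equations. *)
Lemma darboux_quotient xi (x : R) : xi != 0 ->
  darboux_mx (sinh xi) x *m invmx (darboux_mx (cosh xi) x) =
  mx2 (tanh xi) (- (csch xi * sech xi * x)) 0 (coth xi).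
Proof.
move=> xi0; have s0 := sinh_neq0 xi0; have c0 := cosh_neq0 xi.
rewrite invmx_adj2 ?det_darboux_mx // /darboux_mx adj2Z -scalemxAl -scalemxAr.
rewrite scalerA -invfM mulrACA -expr2 sqr_sqrt2 adj2_mx2 mul_mx2 scale_mx2.
rewrite /tanh /coth /csch /sech.
congr mx2; try by field; rewrite ?s0 ?c0.
rewrite [in RHS](_ : x = x * (cosh xi ^+ 2 - sinh xi ^+ 2)).
  by field; rewrite ?s0 ?c0.
by rewrite cosh_sqr addrK mulr1.
Qed.

(** Energies 1 and -1 lie below cosh (2 xi) by 2 sinh^2 xi and 2 cosh^2 xi, so
the same f gives Darboux transformations of both frame equations, and both
change k into k - 2 f', which the Riccati equation turns into the function
below. *)
Lemma spinor_system_Ttransform J eps xi f g Fp Fm : open J ->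
  eps = 1 \/ eps = -1 -> xi != 0 ->
  spinor_frame J g Fp Fm -> riccati J (bending g) xi f ->
  spinor_system J (fun s => 2 * f s ^+ 2 - bending g s - 2 * cosh (2 * xi))
    (Ttransform J eps xi f g)
    (fun s => eps *: (Fp s *m darboux_mx (sinh xi) (f s)))
    (fun s => Fm s *m darboux_mx (cosh xi) (f s)).
Proof.
move=> Jo epsE xi0 frF ric.
have s0 := sinh_neq0 xi0; have c0 := cosh_neq0 xi.
have sg : smooth_on J g := spinor_system_smooth Jo (spinor_frame_system frF).
have fs n : Cn n J f by apply: riccati_Cn ric => // m; exact: Cn_bending.
have eps2 : eps ^+ 2 = 1 by case: epsE => ->; rewrite ?sqrrN expr1n.
have [/smooth_onP sp /smooth_onP sm dp dm _ ep em] := spinor_frame_system frF.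
split.
- apply/smooth_onP => n.
  under eq_fun do rewrite -mul_scalar_mx.
  apply: Cn_mulmx => //; first exact: Cn_cst.
  by apply: Cn_mulmx => //; exact: Cn_darboux.
- by apply/smooth_onP => n; apply: Cn_mulmx => //; exact: Cn_darboux.
- by move=> s Js; rewrite detZ eps2 mul1r det_mulmx dp // mul1r det_darboux_mx.
- by move=> s Js; rewrite det_mulmx dm // det_darboux_mx // mulr1.
- move=> s Js; rewrite (TtransformE _ _ _ Jo frF Js) -darboux_quotient //.
  rewrite !(@invmx_adj2 _ (_ *m _)) ?det_mulmx ?dm ?det_darboux_mx ?mulr1 //.
  by rewrite adj2M -!invmx_adj2 ?dm ?det_darboux_mx // -scalemxAl !mulmxA.
- move=> s Js; have [fd fE] := ric s Js.
  have fder := is_derive_derive1 fd.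
  rewrite -scalemxAl.
  rewrite (_ : 2 * f s ^+ 2 - _ - _ + 1 =
               bending g s + 1 - 2 * derive1 f s).
    apply: is_deriveZ; apply: is_derive_darboux (ep s Js) fder _.
    by rewrite fE cosh_double_sinh; ring.
  rewrite (_ : derive1 f s = bending g s + cosh (2 * xi) - f s ^+ 2).
    by ring.
  by rewrite -fE addrK.
- move=> s Js; have [fd fE] := ric s Js.
  have fder := is_derive_derive1 fd.
  rewrite (_ : 2 * f s ^+ 2 - _ - _ - 1 =
               bending g s - 1 - 2 * derive1 f s).
    apply: is_derive_darboux (em s Js) fder _.
    by rewrite fE cosh_double_cosh; ring.
  rewrite (_ : derive1 f s = bending g s + cosh (2 * xi) - f s ^+ 2).
    by ring.
  by rewrite -fE addrK.
Qed.

Lemma Ttransform_null_curve J eps xi f g : open J -> eps = 1 \/ eps = -1 ->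
  xi != 0 -> framed_null_curve J g -> riccati J (bending g) xi f ->
  framed_null_curve J (Ttransform J eps xi f g).
Proof.
move=> Jo epsE xi0 [_ [Fp [Fm frF]]] ric.
have sys := spinor_system_Ttransform Jo epsE xi0 frF ric.
split; first exact: spinor_system_null_curve sys.
by do 2!eexists; exact: spinor_system_frame sys.
Qed.

Lemma Ttransform_bending J eps xi f g s : open J -> eps = 1 \/ eps = -1 ->
  xi != 0 -> framed_null_curve J g -> riccati J (bending g) xi f -> J s ->
  bending (Ttransform J eps xi f g) s =
  2 * f s ^+ 2 - bending g s - 2 * cosh (2 * xi).
Proof.
move=> Jo epsE xi0 [_ [Fp [Fm frF]]] ric Js.
have sys := spinor_system_Ttransform Jo epsE xi0 frF ric.
exact: (spinor_system_bending Jo sys Js).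
Qed.

(** With D the difference of the two hyperbolic cosines and d = f1 - f2, the
Riccati equations give d' = D - d (f1 + f2); the terms in (D / d)^2 of h' and
h^2 then cancel. *)
Lemma riccati_permuted J k k1 xi1 xi2 f1 f2 h : open J ->
  riccati J k xi1 f1 -> riccati J k xi2 f2 ->
  (forall s, J s -> f1 s != f2 s) ->
  (forall s, J s -> k1 s = 2 * f1 s ^+ 2 - k s - 2 * cosh (2 * xi1)) ->
  (forall s, J s -> h s = - f1 s +
     (cosh (2 * xi1) - cosh (2 * xi2)) / (f1 s - f2 s)) ->
  riccati J k1 xi2 h.
Proof.
move=> Jo ric1 ric2 f12 k1E hE s Js.
have [fd1 fE1] := ric1 s Js; have [fd2 fE2] := ric2 s Js.
set D := cosh (2 * xi1) - cosh (2 * xi2) in hE.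
have d0 : f1 s - f2 s != 0 by rewrite subr_eq0 f12.
have hd : is_derive s 1 h (- derive1 f1 s +
    - D * (derive1 f1 s - derive1 f2 s) / (f1 s - f2 s) ^+ 2).
  apply: (is_derive_eq_on Jo Js hE).
  have Dd : is_derive s 1 (fun t => f1 t - f2 t) (derive1 f1 s - derive1 f2 s).
    exact: is_deriveB (is_derive_derive1 fd1) (is_derive_derive1 fd2).
  have Vd := @is_deriveV _ (fun t => f1 t - f2 t) s _ 1 d0 Dd.
  have Nd := is_deriveN (is_derive_derive1 fd1).
  apply: is_derive_eq (is_deriveD Nd (is_deriveZ D Vd)) _.
  by rewrite /GRing.scale /=; field.
split; first by case: hd.
rewrite (derive1_val hd) hE // k1E //.
have -> : derive1 f1 s = k s + cosh (2 * xi1) - f1 s ^+ 2 by rewrite -fE1 addrK.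
have -> : derive1 f2 s = k s + cosh (2 * xi2) - f2 s ^+ 2 by rewrite -fE2 addrK.
by rewrite /D; field.
Qed.

(** Both sides equal the same matrix, which is seen by computing one of them for
generic arguments and using that, by the choice of q, q (x1 - x2) equals
2 sinh^2 xi1 - 2 sinh^2 xi2. *)
Lemma darboux_permutability (xi1 xi2 x1 x2 : R) :
  xi1 != 0 -> xi2 != 0 -> x1 != x2 ->
  let q := (cosh (2 * xi1) - cosh (2 * xi2)) / (x1 - x2) in
  let T xi x := mx2 (tanh xi) (- (csch xi * sech xi * x)) 0 (coth xi) in
  darboux_mx (sinh xi1) x1 *m T xi2 (- x1 + q)
    *m invmx (darboux_mx (cosh xi1) x1) =
  darboux_mx (sinh xi2) x2 *m T xi1 (- x2 + q)
    *m invmx (darboux_mx (cosh xi2) x2).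
Proof.
move=> xi1_0 xi2_0 x12 q T.
have s1 := sinh_neq0 xi1_0; have c1 := cosh_neq0 xi1.
have s2 := sinh_neq0 xi2_0; have c2 := cosh_neq0 xi2.
have d0 : x1 - x2 != 0 by rewrite subr_eq0.
have sandwichE xi xi' x y : sinh xi != 0 -> sinh xi' != 0 ->
    darboux_mx (sinh xi) x *m T xi' (- x + y)
      *m invmx (darboux_mx (cosh xi) x) =
    (2 * ((sinh xi * cosh xi) * (sinh xi' * cosh xi')))^-1 *:
    mx2 (2 * (1 + sinh xi' ^+ 2) * sinh xi ^+ 2 - x * y)
        (2 * (sinh xi ^+ 2 - sinh xi' ^+ 2) * x - x ^+ 2 * y)
        y (2 * (1 + sinh xi ^+ 2) * sinh xi' ^+ 2 + x * y).
  move=> s0 s0'; have c0 := cosh_neq0 xi; have c0' := cosh_neq0 xi'.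
  have -> : T xi' (- x + y) = (sinh xi' * cosh xi')^-1 *:
      mx2 (sinh xi' ^+ 2) (x - y) 0 (cosh xi' ^+ 2).
    rewrite scale_mx2 /T /tanh /coth /csch /sech.
    by congr mx2; field; rewrite ?s0' ?c0'.
  rewrite invmx_adj2 ?det_darboux_mx // /darboux_mx adj2Z adj2_mx2.
  rewrite -!(scalemxAl, scalemxAr) !scalerA !mul_mx2 !cosh_sqr.
  congr (_ *: mx2 _ _ _ _); try ring.
  rewrite -!invfM; congr (_^-1); rewrite -[2 in RHS]sqr_sqrt2; ring.
rewrite !sandwichE // [_ * (sinh xi2 * cosh xi2)]mulrC.
(* in this form the exchange of the indices is a polynomial identity *)
have q12 : sinh xi1 ^+ 2 = sinh xi2 ^+ 2 + q * (x1 - x2) / 2.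
  by rewrite /q !cosh_double_sinh; field.
by rewrite q12; congr (_ *: mx2 _ _ _ _); field.
Qed.

(** The signs of the two transforms multiply to eps^2 in either order, and what
is left between F_+ and F_-^-1 is symmetric by [darboux_permutability]. *)
Lemma Ttransform_permuted J eps xi1 xi2 f1 f2 h1 h2 g s :
  open J -> eps = 1 \/ eps = -1 -> xi1 != 0 -> xi2 != 0 ->
  framed_null_curve J g ->
  riccati J (bending g) xi1 f1 -> riccati J (bending g) xi2 f2 ->
  J s -> f1 s != f2 s ->
  h1 s = - f1 s + (cosh (2 * xi1) - cosh (2 * xi2)) / (f1 s - f2 s) ->
  h2 s = - f2 s + (cosh (2 * xi1) - cosh (2 * xi2)) / (f1 s - f2 s) ->
  Ttransform J eps xi2 h1 (Ttransform J eps xi1 f1 g) s =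
  Ttransform J eps xi1 h2 (Ttransform J eps xi2 f2 g) s.
Proof.
move=> Jo epsE xi1_0 xi2_0 [_ [Fp [Fm frF]]] ric1 ric2 Js f12 h1E h2E.
have := frF => -[_ _ _ dm _ _ _].
have compE xi xi' f h : xi != 0 -> riccati J (bending g) xi f ->
    Ttransform J eps xi' h (Ttransform J eps xi f g) s =
    eps ^+ 2 *: (Fp s *m (darboux_mx (sinh xi) (f s) *m
      mx2 (tanh xi') (- (csch xi' * sech xi' * h s)) 0 (coth xi') *m
      invmx (darboux_mx (cosh xi) (f s))) *m invmx (Fm s)).
  move=> xi0 ric; have sys := spinor_system_Ttransform Jo epsE xi0 frF ric.
  rewrite (TtransformE _ _ _ Jo (spinor_system_frame Jo sys) Js).
  have c0 := cosh_neq0 xi.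
  rewrite (@invmx_adj2 _ (_ *m _)) ?det_mulmx ?dm ?det_darboux_mx ?mulr1 //.
  rewrite adj2M -!invmx_adj2 ?dm ?det_darboux_mx //.
  by rewrite -![in LHS]scalemxAl scalerA !mulmxA.
rewrite (compE _ xi2 _ h1 xi1_0 ric1) (compE _ xi1 _ h2 xi2_0 ric2) h1E h2E.
by have /= -> := darboux_permutability xi1_0 xi2_0 f12.
Qed.

End Transform.

Theorem theorem3p10 (R : realType) (eps : R) (heps : eps = 1 \/ eps = -1)
    (J : set R) (hJo : open J) (hJi : is_interval J)
    (g : R -> 'M[R]_2) (hg : framed_null_curve J g)
    (xi1 xi2 : R) (hxi1 : xi1 != 0) (hxi2 : xi2 != 0) (hxi : xi1 != xi2)
    (f1 f2 : R -> R)
    (hf1 : riccati J (bending g) xi1 f1) (hf2 : riccati J (bending g) xi2 f2)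
    (hf : forall s, J s -> f1 s != f2 s) :
  let D := cosh (2 * xi1) - cosh (2 * xi2) in
  let g1 := Ttransform J eps xi1 f1 g in
  let g2 := Ttransform J eps xi2 f2 g in
  let f21 := fun s => - f1 s + D / (f1 s - f2 s) in
  let f12 := fun s => - f2 s + D / (f1 s - f2 s) in
  let g21 := Ttransform J eps xi2 f21 g1 in
  let g12 := Ttransform J eps xi1 f12 g2 in
  let k21 := fun s => bending g s
               - 2 * D * ((f1 s + f2 s) / (f1 s - f2 s))
               + 2 * (D / (f1 s - f2 s)) ^+ 2 in
  [/\ framed_null_curve J g1, framed_null_curve J g2,
      framed_null_curve J g21 & framed_null_curve J g12] /\
  [/\ riccati J (bending g1) xi2 f21,
      riccati J (bending g2) xi1 f12,
      forall s, J s -> g21 s = g12 s,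
      forall s, J s -> bending g21 s = k21 s &
      forall s, J s -> bending g12 s = k21 s].
Proof.
move=> D g1 g2 f21 f12 g21 g12 k21.
have f12_neq0 s : J s -> f1 s - f2 s != 0 by move=> /hf; rewrite subr_eq0.
have g1_null : framed_null_curve J g1 by exact: Ttransform_null_curve.
have g2_null : framed_null_curve J g2 by exact: Ttransform_null_curve.
have k1E s (Js : J s) := Ttransform_bending hJo heps hxi1 hg hf1 Js.
have k2E s (Js : J s) := Ttransform_bending hJo heps hxi2 hg hf2 Js.
have ric21 : riccati J (bending g1) xi2 f21.
  exact: (riccati_permuted hJo hf1 hf2 hf k1E).
have ric12 : riccati J (bending g2) xi1 f12.
  apply: (riccati_permuted hJo hf2 hf1 _ k2E) => s Js.
    by rewrite eq_sym hf.
  by rewrite /f12 -(opprB (f1 s)) -(opprB (cosh (2 * xi1))) invrN mulrNN.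
have k21E s (Js : J s) := Ttransform_bending hJo heps hxi2 g1_null ric21 Js.
have k12E s (Js : J s) := Ttransform_bending hJo heps hxi1 g2_null ric12 Js.
split; split.
- exact: g1_null.
- exact: g2_null.
- exact: Ttransform_null_curve ric21.
- exact: Ttransform_null_curve ric12.
- exact: ric21.
- exact: ric12.
- move=> s Js.
  exact: (Ttransform_permuted hJo heps hxi1 hxi2 hg hf1 hf2 Js (hf s Js)).
- move=> s Js; rewrite (k21E s Js) (k1E s Js) /f21 /k21 /D.
  by field; exact: f12_neq0.
- move=> s Js; rewrite (k12E s Js) (k2E s Js) /f12 /k21 /D.
  by field; exact: f12_neq0.
Qed.
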